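(* Let $G=(V,E)$ be an undirected $d$-regular graph of diameter $3$ with $n=\alpha\cdot d^3$ vertices. Then $$\phi_V(G)\ge\frac{\alpha}{\alpha+1}.$$
   Context: Graphs are finite and simple; the diameter is the maximum distance between two vertices. The vertex expansion is $\phi_V(G):=\min_{0<|S|\le n/2}\frac{|N(S)|}{|S|}$, where $S$ ranges over subsets of $V$ and $N(S):=\{v\in V\setminus S:\exists u\in S\text{ with }(u,v)\in E\}$. *)

(* Defs.v *)
From mathcomp Require Import all_boot all_order all_algebra.

Set Implicit Arguments.
Unset Strict Implicit.
Unset Printing Implicit Defensive.

Import Order.TTheory GRing.Theory Num.Theory.

Section Graph.

Variables (T : finType) (e : rel T).

Definition simple_graph : Prop := symmetric e /\ irreflexive e.

Definition regular (d : nat) : Prop := forall x : T, #|[set y | e x y]| = d.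

Definition walk (k : nat) (x y : T) : bool :=
  [exists p : k.-tuple T, path e x p && (last x p == y)].

(* In a finite graph a shortest path has fewer than #|T| edges, so searching
   k < #|T| suffices; the junk value #|T| is returned when y is not reachable
   from x. *)
Definition dist (x y : T) : nat := find (fun k => walk k x y) (iota 0 #|T|).

(* Connectedness is required explicitly: a disconnected graph has infinite
   diameter, whatever the junk values of dist. *)
Definition has_diameter (D : nat) : Prop :=
  (forall x y : T, connect e x y) /\ \max_(x : T) \max_(y : T) dist x y = D.

Definition vneigh (S : {set T}) : {set T} :=
  [set v in ~: S | [exists u in S, e u v]].

(* The neutral value #|T| of the iterated minimum exceeds every ratio it ranges
   over (|N(S)| < |T| and |S| >= 1), so it never affects the minimum when
   the range is nonempty, i.e. when there are at least two vertices. *)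
Definition vertex_expansion (R : realFieldType) : R :=
  (\big[Num.min/#|T|%:R]_(S : {set T} | (0 < #|S|)%N && (2 * #|S| <= #|T|)%N)
     (#|vneigh S|%:R / #|S|%:R))%R.

End Graph.

(* Main.v *)
(** Fix [S] with neighbourhood [N] and let [U] be the remaining vertices. Every
pair in [S * U] is joined by a walk of length 2 or 3, which must cross [N], so
[#|S| * #|U|] is at most the number of such walks. A vertex of [N] with [a]
neighbours in [S], [b] in [U] and [c] in [N] carries at most [2 * a * b * d]
walks meeting [N] only there; the walks through an edge inside [N] are shared
between its two ends by AM-GM, which charges at most [c * (a ^ 2 + b ^ 2) / 2]
to each vertex. As [a + b + c = d], the total charge of a vertex is at most
[d ^ 3 / 2], whence [2 * #|S| * #|U| <= #|N| * d ^ 3]. *)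

Require Import Defs.
From mathcomp Require Import all_boot all_order all_algebra.
From mathcomp Require Import zify lra.

Set Implicit Arguments.
Unset Strict Implicit.
Unset Printing Implicit Defensive.

Import Order.TTheory GRing.Theory Num.Theory.

Section NatSums.

Variable T : finType.

Lemma sum_in_gt0 (A : {set T}) (F : T -> nat) (x : T) :
  x \in A -> 0 < F x -> 0 < \sum_(y in A) F y.
Proof. by move=> xA Fx; rewrite (bigD1 x) //= ltn_addr. Qed.

(** For a fixed middle edge [x y], the choices of the two ends [s] and [t] are independent. This
    turns counts of three-step walks into sums over middle edges. *)
Lemma sum_chain (A B C D : {set T}) (f g h : T -> T -> nat) :
  \sum_(s in A) \sum_(t in D) \sum_(x in B) \sum_(y in C) f s x * g x y * h y t
  = \sum_(x in B) \sum_(y in C)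
      (\sum_(s in A) f s x) * g x y * (\sum_(t in D) h y t).
Proof.
under eq_bigr => s _ do rewrite exchange_big /=.
rewrite exchange_big /=; apply: eq_bigr => x _.
under eq_bigr => s _ do rewrite exchange_big /=.
rewrite exchange_big /=; apply: eq_bigr => y _.
rewrite !big_distrl /=; apply: eq_bigr => s _.
by rewrite big_distrr.
Qed.

End NatSums.

(** Twice the charge of a vertex with $a+b+c=d$. The part without $c$ is AM-GM times $a+b$; the rest
    is $c((a+b)^2+2ab) \le 3c(a+b)^2$, a term of the expanded cube. *)
Lemma cubic_charge (a b c : nat) :
  4 * (a * b * (a + b + c)) + c * (a ^ 2 + b ^ 2) <= (a + b + c) ^ 3.
Proof.
have abE : 4 * (a * b) <= (a + b) ^ 2 by rewrite nat_AGM2.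
have h1 : 4 * (a * b) * (a + b) <= (a + b) ^ 3.
  by rewrite (expnSr _ 2) leq_mul2r abE orbT.
nia.
Qed.

Section Graph.

Variables (T : finType) (e : rel T).

(** A repetition-free path has fewer than [#|T|] edges, so the search defining [dist] succeeds and
    the junk value is not returned. *)
Lemma walk_dist (x y : T) : connect e x y -> walk e (dist e x y) x y.
Proof.
move=> /connectP [p0 /shortenP [p pe p_uniq _] ylast].
have szp : size p < #|T| by rewrite -[_.+1](card_uniqP p_uniq) max_card.
have hasw : has (fun k => walk e k x y) (iota 0 #|T|).
  apply/hasP; exists (size p); first by rewrite mem_iota.
  by apply/existsP; exists (in_tuple p); rewrite pe ylast eqxx.
have := nth_find 0 hasw; rewrite nth_iota ?add0n //.
by move: hasw; rewrite has_find size_iota.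
Qed.

Lemma has_diameter_walk (D : nat) (x y : T) : has_diameter e D ->
  exists2 p : seq T, size p <= D & path e x p && (last x p == y).
Proof.
move=> [conn diam]; have /existsP [p pP] := walk_dist (conn x y).
exists p => //; rewrite size_tuple -diam.
by rewrite (leq_trans _ (leq_bigmax x)) // (leq_bigmax y).
Qed.

Definition far (S : {set T}) : {set T} := ~: (S :|: vneigh e S).

(** A step that may stay in place: it pads a walk of length 2 to three steps. *)
Definition adj_or_eq (x y : T) : bool := (x == y) || e x y.

Lemma card_far (S : {set T}) : #|S| + #|vneigh e S| + #|far S| = #|T|.
Proof.
rewrite -(cardsC (S :|: vneigh e S)); congr (_ + _).
rewrite cardsU; suff -> : S :&: vneigh e S = set0 by rewrite cards0 subn0.
by apply/setP => x; rewrite !inE; case: (x \in S).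
Qed.

Lemma sum_far (S : {set T}) (F : T -> nat) :
  \sum_x F x
  = \sum_(x in S) F x + \sum_(x in far S) F x + \sum_(x in vneigh e S) F x.
Proof.
have -> : \sum_x F x = \sum_(x in [set: T]) F x by apply: eq_bigl => x; rewrite inE.
rewrite (big_setID S) /= setTI -addnA; congr (_ + _).
rewrite (big_setID (vneigh e S)) /= addnC; congr (_ + _);
  by apply: eq_bigl => x; rewrite !inE; case: (x \in S); rewrite ?andbF ?andbT.
Qed.

Hypothesis e_sym : symmetric e.

Lemma not_adj_far (S : {set T}) (s t : T) :
  s \in S -> t \in far S -> e s t = false.
Proof.
move=> sS; rewrite !inE negb_or => /andP [tS]; rewrite tS /=.
by move=> /existsPn /(_ s); rewrite sS => /negbTE.
Qed.

(** No edge joins [S] to [far S], so an inner vertex lies in the neighbourhood. The three sums cover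
    the cases that only [y], only [x], or both do; a walk of length 2 idles at [s] and falls under
    the first. *)
Lemma far_walks (S : {set T}) (s t : T) :
  has_diameter e 3 -> s \in S -> t \in far S ->
  0 < \sum_(x in S) \sum_(y in vneigh e S) adj_or_eq s x * e x y * e y t
    + \sum_(x in vneigh e S) \sum_(y in far S) e s x * e x y * adj_or_eq y t
    + \sum_(x in vneigh e S) \sum_(y in vneigh e S) e s x * e x y * e y t.
Proof.
move=> diam sS tU.
have mem3 (z : T) : [|| z \in S, z \in vneigh e S | z \in far S].
  by rewrite [_ \in far S]inE in_setU; case: (z \in S) => //=; apply: orbN.
have tS : t \notin S by move: tU; rewrite inE in_setU negb_or => /andP [].
have [p] := has_diameter_walk s t diam.
case: p => [|x [|y [|z [|? ?]]]] //= _.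
- by move=> /eqP st; rewrite -st sS in tS.
- by move=> /andP [/andP [est _] /eqP xt]; rewrite xt (not_adj_far sS tU) in est.
- move=> /andP [/and3P [esx exy _] /eqP yt]; rewrite {}yt in exy.
  have xN : x \in vneigh e S.
    have /or3P [xS|//|xU] := mem3 x.
      by rewrite (not_adj_far xS tU) in exy.
    by rewrite (not_adj_far sS xU) in esx.
  rewrite -addnA ltn_addr // (sum_in_gt0 sS) // (sum_in_gt0 xN) //.
  by rewrite /adj_or_eq eqxx esx exy.
move=> /andP [/and4P [esx exy eyz _] /eqP zt]; rewrite {}zt in eyz.
have /or3P [xS|xN|xU] := mem3 x; last by rewrite (not_adj_far sS xU) in esx.
- have /or3P [yS|yN|yU] := mem3 y.
  + by rewrite (not_adj_far yS tU) in eyz.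
  + rewrite -addnA ltn_addr // (sum_in_gt0 xS) // (sum_in_gt0 yN) //.
    by rewrite /adj_or_eq esx exy eyz orbT.
  + by rewrite (not_adj_far xS yU) in exy.
have /or3P [yS|yN|yU] := mem3 y.
- by rewrite (not_adj_far yS tU) in eyz.
- rewrite ltn_addl // (sum_in_gt0 xN) // (sum_in_gt0 yN) //.
  by rewrite esx exy eyz.
- rewrite addnAC ltn_addl // (sum_in_gt0 xN) // (sum_in_gt0 yU) //.
  by rewrite /adj_or_eq esx exy eyz orbT.
Qed.

Variable d : nat.
Hypothesis e_reg : regular e d.

Lemma regular_sum (x : T) : \sum_y e x y = d.
Proof.
rewrite -(e_reg x) -sum1dep_card [RHS]big_mkcond /=.
by apply: eq_bigr => y _; case: (e x y).
Qed.

(* The neighbour [z] outside [A] pays for the term [x = y]. *)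
Lemma sum_adj_or_eq (A : {set T}) (y z : T) : z \notin A -> e y z ->
  \sum_(x in A) adj_or_eq x y <= d.
Proof.
move=> zA eyz; rewrite -(regular_sum y) [leqRHS](bigID (mem A)) /=.
apply: (@leq_trans (\sum_(x in A) (e y x + (x == y)))).
  by apply: leq_sum => x _; rewrite /adj_or_eq e_sym; case: (x == y); case: (e y x).
rewrite big_split /= leq_add2l [leqRHS](bigD1 z) //= eyz.
apply: (@leq_trans 1); last exact: leq_addr.
have [yA|yA] := boolP (y \in A).
  by rewrite (bigD1 y) //= eqxx big1 // => x /andP [_ /negbTE ->].
by rewrite big1 // => x xA; case: eqP => // xy; rewrite -xy xA in yA.
Qed.

Lemma card_far_bound (S : {set T}) : has_diameter e 3 ->
  2 * (#|S| * #|far S|) <= #|vneigh e S| * d ^ 3.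
Proof.
move=> diam; set N := vneigh e S; set U := far S.
pose a x := \sum_(s in S) e s x.
pose b x := \sum_(t in U) e x t.
pose c x := \sum_(y in N) e x y.
have NS x : x \in N -> x \notin S by rewrite !inE => /andP [].
have NU x : x \in N -> x \notin U.
  by move=> xN; rewrite inE negbK in_setU [_ \in vneigh _ _]xN orbT.
have abc x : a x + b x + c x = d.
  rewrite -(regular_sum x) (sum_far S); congr (_ + _ + _).
  by apply: eq_bigr => s _; rewrite e_sym.
have le1 : #|S| * #|U| <=
    \sum_(x in S) \sum_(y in N) (\sum_(s in S) adj_or_eq s x) * e x y * b y
    + \sum_(x in N) \sum_(y in U) a x * e x y * (\sum_(t in U) adj_or_eq y t)
    + \sum_(x in N) \sum_(y in N) a x * e x y * b y.
  rewrite /a /b -!sum_chain -!big_split /= -sum_nat_const; apply: leq_sum => s sS.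
  by rewrite -!big_split /= -sum1_card; apply: leq_sum => t tU; apply: far_walks.
(* The edge from [x] leads to [y] outside [S], so at most [d] starts [s] are possible, idle ones
   included; [y] is charged. *)
have le2 : \sum_(x in S) \sum_(y in N) (\sum_(s in S) adj_or_eq s x) * e x y * b y
    <= \sum_(y in N) a y * b y * d.
  rewrite exchange_big /=; apply: leq_sum => y yN.
  rewrite mulnAC [a y * d]mulnC /a [d * _]big_distrr big_distrl /=; apply: leq_sum => x _.
  have [exy|_] := boolP (e x y); last by rewrite !muln0.
  by rewrite leq_mul2r leq_mul2r (sum_adj_or_eq (NS y yN) exy) !orbT.
have le3 : \sum_(x in N) \sum_(y in U) a x * e x y * (\sum_(t in U) adj_or_eq y t)
    <= \sum_(y in N) a y * b y * d.
  apply: leq_sum => x xN.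
  rewrite /b [a x * _]big_distrr big_distrl /=; apply: leq_sum => y _.
  have [exy|_] := boolP (e x y); last by rewrite !muln0.
  rewrite leq_mul2l (eq_bigr (fun t => adj_or_eq t y : nat)); last first.
    by move=> t _; rewrite /adj_or_eq eq_sym e_sym.
  by rewrite (sum_adj_or_eq (NU x xN)) ?orbT // e_sym.
(* AM-GM on [a x * b y]; by symmetry of [e], the term [b y ^ 2] is moved to the end [y] of the
   edge. *)
have le4 : 2 * (\sum_(x in N) \sum_(y in N) a x * e x y * b y)
    <= \sum_(x in N) c x * (a x ^ 2 + b x ^ 2).
  have -> : \sum_(x in N) c x * (a x ^ 2 + b x ^ 2)
      = \sum_(x in N) \sum_(y in N) e x y * (a x ^ 2 + b y ^ 2).
    under eq_bigr => x _ do rewrite mulnDr /c !big_distrl /=.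
    rewrite big_split /= [X in _ + X]exchange_big -big_split /=.
    apply: eq_bigr => x _; rewrite -big_split /=; apply: eq_bigr => y _.
    by rewrite mulnDr e_sym.
  rewrite big_distrr; apply: leq_sum => x _ /=.
  rewrite big_distrr; apply: leq_sum => y _ /=.
  by case: (e x y); rewrite ?muln0 // muln1 mul1n nat_Cauchy.
have le5 : \sum_(x in N) (4 * (a x * b x * d) + c x * (a x ^ 2 + b x ^ 2))
    <= #|N| * d ^ 3.
  rewrite -sum_nat_const; apply: leq_sum => x _.
  by rewrite -(abc x) cubic_charge.
move: le5; rewrite big_split /= -big_distrr /=.
lia.
Qed.

(** With $N$ the neighbourhood and $U$ the far set, $|S| \le |N|+|U|$ gives $|T||S| \le 2|S||N| +
    2|S||U|$, where $2|S| \le |T|$ and $2|S||U| \le |N|d^3$. *)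
Lemma expansion_bound (S : {set T}) : has_diameter e 3 -> 2 * #|S| <= #|T| ->
  #|T| * #|S| <= #|vneigh e S| * (#|T| + d ^ 3).
Proof.
move=> diam; have := card_far_bound S diam; rewrite -(card_far S).
move: (d ^ 3) => D; nia.
Qed.

End Graph.

Local Open Scope ring_scope.

Theorem theorem4p7 (R : realFieldType) (T : finType) (e : rel T) (d : nat)
    (alpha : R) (simple_e : simple_graph e) (regular_e : regular e d)
    (diameter_e : has_diameter e 3) (card_T : #|T|%:R = alpha * d%:R ^+ 3) :
  alpha / (alpha + 1) <= vertex_expansion e R.
Proof.
have T_gt0 : (0 < #|T|)%N.
  (* Over an empty vertex set the maximal distance would be 0, not 3. *)
  rewrite lt0n; apply/eqP => T0; have [_] := diameter_e.
  by rewrite big1 // => x; have := card0_eq T0 x.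
have D_gt0 : 0 < d%:R ^+ 3 :> R.
  rewrite exprn_gt0 // ltr0n lt0n; apply/eqP => d0; move: card_T T_gt0.
  by rewrite d0 expr0n /= mulr0 => /eqP; rewrite pnatr_eq0 => /eqP ->.
have alpha_gt0 : 0 < alpha.
  by rewrite -(pmulr_lgt0 _ D_gt0) -card_T ltr0n.
have alpha1_gt0 : 0 < alpha + 1 by rewrite addr_gt0.
rewrite /vertex_expansion; elim/big_ind: _ => [|u v ule vle|S /andP [S_gt0 S_le]].
(* The neutral value [#|T|] is at least 1, which exceeds the claimed bound. *)
- apply: (@le_trans _ _ 1); last by rewrite ler1n.
  by rewrite ler_pdivrMr // mul1r lerDl.
- by rewrite le_min ule vle.
have [e_sym _] := simple_e.
rewrite ler_pdivrMr // mulrAC ler_pdivlMr ?ltr0n //.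
have := expansion_bound e_sym regular_e diameter_e S_le.
rewrite -(ler_nat R) !natrM natrD natrX card_T => bound.
(* As $|T| = \alpha d^3$, [bound] is the goal multiplied by $d^3$. *)
rewrite -(ler_pM2r D_gt0); nra.
Qed.
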